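(* Let $\phi\in\mathrm{N}_{\mathrm{GL}(X)}(W)$ be an automorphism of finite order $n>0$ and let $\mathbb{K}=\mathbb{Q}(\mu_n)\subseteq\mathbb{C}$. Let $d>0$ be an integer and let $\zeta\in\mu_d^*$ be a primitive $d$th root of unity. Then for any subset $\Sigma\subseteq\Phi$, the set $\Phi\cap\theta_{\zeta}^{-1}(\theta_{\zeta}(X_{\mathbb{K},\Sigma}))$ is the smallest $(\phi,d)$-split Levi subsystem containing $\Sigma$ (that is, it is a $(\phi,d)$-split Levi subsystem containing $\Sigma$, and it is contained in every $(\phi,d)$-split Levi subsystem containing $\Sigma$). In particular, $\Sigma$ is a $(\phi,d)$-split Levi subsystem if and only if $\Sigma=\Phi\cap\theta_{\zeta}^{-1}(\theta_{\zeta}(X_{\mathbb{K},\Sigma}))$.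
   Context: Let $(X,\check{X})$ be a pair of finite rank free $\mathbb{Z}$-modules with a perfect pairing $\langle-,-\rangle : X\times\check{X}\to\mathbb{Z}$; for a field $\mathbb{K}$ of characteristic $0$ let $X_{\mathbb{K}} = \mathbb{K}\otimes_{\mathbb{Z}}X$, and for $\Sigma\subseteq X_{\mathbb{K}}$ let $X_{\mathbb{K},\Sigma}$ be the $\mathbb{K}$-span of $\Sigma$. Let $\Phi\subseteq X$ be a non-empty finite subset with an injection $\Phi\to\check{X}$, $\alpha\mapsto\check{\alpha}$, such that $\langle\alpha,\check\alpha\rangle=2$ and $s_{\alpha,\check\alpha}(\Phi)\subseteq\Phi$ for all $\alpha\in\Phi$, where $s_{\alpha,\check\alpha}(x)=x-\langle x,\check\alpha\rangle\alpha$. Then $\Phi$ is a root system in its real span, and it is assumed to be reduced. Let $W=\langle s_{\alpha,\check\alpha}\mid\alpha\in\Phi\rangle$, a finite group acting on $X$. The automorphism $\phi$ of $X$ is also regarded as an element of $\mathrm{GL}(X_{\mathbb{K}})$. $\mu_d\leqslant\mathbb{C}^{\times}$ is the group of $d$th roots of unity and $\mu_d^*\subseteq\mu_d$ the subset of elements of order $d$. $X_{\mathbb{K}}(\phi,\zeta)$ is the $\zeta$-eigenspace of $\phi$ on $X_{\mathbb{K}}$ (taken to be $\{0\}$ if $\zeta\notin\mathbb{K}$), and $X_{\mathbb{K}}(\phi,d)=\bigoplus_{\zeta\in\mu_d^*}X_{\mathbb{K}}(\phi,\zeta)$; this is $\{0\}$ if $d\nmid n$. The Galois group $\mathcal{G}=\mathrm{Gal}(\mathbb{K}/\mathbb{Q})$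 acts semilinearly on $X_{\mathbb{K}}=\mathbb{K}\otimes_{\mathbb{Q}}X_{\mathbb{Q}}$ via the first factor, and $X_{\mathbb{Q}}(\phi,d):=X_{\mathbb{K}}(\phi,d)^{\mathcal{G}}$ is the resulting $\mathbb{Q}$-subspace of $X_{\mathbb{Q}}$. Fix a $W\langle\phi\rangle$-invariant positive definite symmetric bilinear form $(-\mid-)$ on $X_{\mathbb{Q}}$, extended $\mathbb{K}$-bilinearly to $X_{\mathbb{K}}$. For $E\subseteq X_{\mathbb{K}}$, $E^{\perp}=\{x\in X_{\mathbb{K}}\mid(x\mid e)=0\text{ for all }e\in E\}$ and $\Phi^E=\Phi\cap E^{\perp}$. A subset $\Sigma\subseteq\Phi$ is a $(\phi,d)$-split Levi subsystem if $\Sigma=\Phi^E$ for some $\phi$-stable $\mathbb{Q}$-subspace $E\subseteq X_{\mathbb{Q}}(\phi,d)$. $\theta_{\zeta}:X_{\mathbb{K}}\to X_{\mathbb{K}}(\phi,\zeta)$ is the eigenspace projector onto the $\zeta$-eigenspace of $\phi$, i.e. the projection whose kernel is the sum of all the other eigenspaces of $\phi$ on $X_{\mathbb{K}}$ (note that $\phi$ is diagonalisable over $\mathbb{K}$). *)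

(* Defs.v *)
From HB Require Import structures.
From mathcomp Require Import all_boot all_order all_fingroup all_algebra all_field.
From mathcomp Require Import sesquilinear finmap.
From mathcomp Require Import boolp classical_sets fsbigop reals complex.

Set Implicit Arguments.
Unset Strict Implicit.
Unset Printing Implicit Defensive.

Import GRing.Theory Num.Theory VectorInternalTheory.

Local Open Scope ring_scope.
Local Open Scope classical_set_scope.

(* Free Z-modules of finite rank are the [vectType int]s.  For a ring F, the
   scalar extension F (x) X is taken in the coordinates v2r that are part of the
   structure of X: it is the space of row vectors F^(dim X), and [base_change F x]
   is the element 1 (x) x.  In the same coordinates an endomorphism f of X is
   right multiplication by the integer matrix f2mx f. *)
Notation scalar_ext F X := 'rV[F]_(dim X).

Definition base_change (F : nzRingType) (X : vectType int) (x : X) :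
  scalar_ext F X := map_mx intr (v2r x).
Arguments base_change F {X} x.

Definition base_change_end (F : fieldType) (X : vectType int) (f : 'End(X)) :
  'End(scalar_ext F X) := linfun (mulmxr (map_mx intr (f2mx f))).
Arguments base_change_end F {X} f.

Section RootDatum.
Variables (X Xv : vectType int).

Definition perfect (pairing : {bilinear X -> Xv -> int | *%R & *%R}) : Prop :=
  (forall f : {scalar Xv}, exists! x : X, forall y, pairing x y = f y) /\
  (forall f : {scalar X}, exists! y : Xv, forall x, pairing x y = f x).

Variables (pairing : {bilinear X -> Xv -> int | *%R & *%R}).

Definition reflection (a : X) (av : Xv) : 'End(X) :=
  linfun (fun x : X => x - pairing x av *: a).

Definition root_system (Phi : {fset X}) (coroot : X -> Xv) : Prop :=
  [/\ Phi != fset0,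
      {in Phi &, injective coroot},
      (forall a, a \in Phi -> pairing a (coroot a) = 2) &
      (forall a b, a \in Phi -> b \in Phi ->
         reflection a (coroot a) b \in Phi)].

(* Reducedness in the real span of Phi. *)
Definition reduced (R : realType) (Phi : {fset X}) : Prop :=
  forall a b (c : R), a \in Phi -> b \in Phi ->
    base_change R b = c *: base_change R a -> b = a \/ b = - a.

Inductive generated (S : set 'End(X)) : 'End(X) -> Prop :=
| generated_gen f of S f : generated S f
| generated_id : generated S \1%VF
| generated_comp f g of generated S f & generated S g :
    generated S (f \o g)%VF
| generated_inv f g of generated S f & (f \o g)%VF = \1%VF & (g \o f)%VF = \1%VF :
    generated S g.

Definition weyl_group (Phi : {fset X}) (coroot : X -> Xv) : set 'End(X) :=
  generated [set reflection a (coroot a) | a in [set` Phi]].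

End RootDatum.

Section Automorphisms.
Variable X : vectType int.

Definition has_order (phi : 'End(X)) (n : nat) : Prop :=
  [/\ (0 < n)%N,
      (forall x, iter n phi x = x) &
      (forall m, (0 < m)%N -> (forall x, iter m phi x = x) -> (n <= m)%N)].

Definition in_normalizer (W : set 'End(X)) (phi : 'End(X)) : Prop :=
  bijective phi /\
  [set (phi \o w)%VF | w in W] = [set (w \o phi)%VF | w in W].

End Automorphisms.

(* K, embedded in C by iota, is Q(mu_n): it is generated over Q by elements
   whose images under iota are exactly the n-th roots of unity of C. *)
Definition is_cyclotomic (R : realType) (n : nat) (K : splittingFieldType rat)
    (iota : {rmorphism K -> R[i]}) : Prop :=
  exists2 s : seq K,
    forall z : R[i], (z \in map iota s) = n.-unity_root z &
    <<1 & s>>%VS = fullv.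

Section Eigenspaces.
Variables (R : realType) (K : splittingFieldType rat).
Variable (iota : {rmorphism K -> R[i]}).
Variable (X : vectType int) (phi : 'End(X)).
Local Notation XK := (scalar_ext K X).

(* X_K(phi, zeta), which is 0 if zeta is not in K. *)
Definition eigenspaceK (zeta : R[i]) : {vspace XK} :=
  if pselect (exists z : K, iota z = zeta) is left zeta_in_K
  then passmx.leigenspace (base_change_end K phi) (sval (cid zeta_in_K))
  else 0%VS.

(* Sums over possibly infinite sets range over the indices of nonzero
   summands; here there are finitely many of these. *)
Definition eigenspace_ord (d : nat) : {vspace XK} :=
  \big[@addv K XK / 0%VS]_(zeta \in [set z : R[i] | d.-primitive_root z])
    eigenspaceK zeta.

(* As phi has finite order it is diagonalisable over K, so the two subspaces
   below are complementary and this projection is determined everywhere. *)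
Definition eigen_proj (zeta : R[i]) : 'End(XK) :=
  daddv_pi (eigenspaceK zeta)
    (\big[@addv K XK / 0%VS]_(xi \in [set xi : R[i] | xi != zeta])
      eigenspaceK xi).

Definition galois_act (g : gal_of {:K}) (v : XK) : XK := map_mx g v.

(* X_Q(phi, d), as a subset of X_K. *)
Definition eigenspace_ordQ (d : nat) : set XK :=
  [set v | v \in eigenspace_ord d /\
           forall g, g \in ('Gal({:K} / 1))%g -> galois_act g v = v].

Definition XQ_to_XK (v : scalar_ext rat X) : XK := map_mx (in_alg K) v.

(* The bilinear form on X_Q is given by its Gram matrix B. *)
Definition formQ (B : 'M[rat]_(dim X)) (x y : scalar_ext rat X) : rat :=
  (x *m B *m y^T) 0 0.

Definition invariant_form (W : set 'End(X)) (B : 'M[rat]_(dim X)) : Prop :=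
  [/\ (forall x y, formQ B x y = formQ B y x),
      (forall x, x != 0 -> 0 < formQ B x x) &
      (forall g, generated (W `|` [set phi]) g -> forall x y,
         formQ B (base_change_end rat g x) (base_change_end rat g y)
         = formQ B x y)].

Definition formK (B : 'M[rat]_(dim X)) (x y : XK) : K :=
  (x *m map_mx (in_alg K) B *m y^T) 0 0.

Definition perp (B : 'M[rat]_(dim X)) (E : set XK) : set XK :=
  [set x | forall e, E e -> formK B x e = 0].

Definition roots_perp (B : 'M[rat]_(dim X)) (Phi : {fset X}) (E : set XK) :
    {fset X} :=
  [fset a in Phi | base_change K a \in perp B E]%fset.

Definition split_levi (B : 'M[rat]_(dim X)) (Phi : {fset X}) (d : nat)
    (Sigma : {fset X}) : Prop :=
  exists E : {vspace scalar_ext rat X},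
    let EK := [set XQ_to_XK e | e in [set e | e \in E]] in
    [/\ (base_change_end rat phi @: E <= E)%VS,
        EK `<=` eigenspace_ordQ d &
        Sigma = roots_perp B Phi EK].

Definition spanK (Sigma : {fset X}) : {vspace XK} :=
  <<[seq base_change K a | a <- Sigma]>>%VS.

(* Phi /\ theta_zeta^-1 (theta_zeta (X_{K,Sigma})) *)
Definition split_closure (Phi : {fset X}) (zeta : R[i]) (Sigma : {fset X}) :
    {fset X} :=
  let theta := eigen_proj zeta in
  [fset a in Phi | base_change K a \in (theta @^-1: (theta @: spanK Sigma))%VS]%fset.

End Eigenspaces.

(* Main.v *)
Require Import Defs.
From HB Require Import structures.
From mathcomp Require Import all_boot all_order all_fingroup all_algebra all_field.
From mathcomp Require Import cyclic sesquilinear finmap.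
From mathcomp Require Import boolp classical_sets cardinality fsbigop reals complex.

(* Write A for the matrix of phi and U for the span of Sigma. A root alpha lies
   in the closure iff every column c over K with U c = 0 and A c = zeta c has
   alpha c = 0. If c is rational with Phi_d(A) c = 0 and U A^i c = 0 for all i,
   then g(A) c with g = Phi_d / (X - zeta) is such a column; the vanishing of
   alpha g(A) c is a relation over Q between the powers of zeta below deg Phi_d,
   and its top coefficient is alpha c. Conversely rational linear algebra passes
   to K. Hence alpha is in the closure iff it kills all these rational columns c,
   which the invariant form identifies with the largest phi-stable
   E <= X_Q(phi, d) orthogonal to Sigma. *)

Set Implicit Arguments.
Unset Strict Implicit.
Unset Printing Implicit Defensive.

Import Order.TTheory GRing.Theory Num.Theory VectorInternalTheory.
Local Open Scope ring_scope.

(** * Polynomials in a square matrix *)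

Lemma map_mxX (R S : pzRingType) (f : {rmorphism R -> S}) N (A : 'M[R]_N) k :
  map_mx f (A ^+ k) = map_mx f A ^+ k.
Proof.
elim: k => [|k IHk]; first by rewrite !expr0 map_mx1.
by rewrite !exprS -mulmxE map_mxM IHk.
Qed.

(* [horner_mx] is only available in positive dimension. *)
Definition poly_mx (R : comNzRingType) N (A : 'M[R]_N) (p : {poly R}) : 'M[R]_N :=
  \sum_(i < size p) p`_i *: A ^+ i.

Section PolyMx.
Variables (R : comNzRingType) (N : nat) (A : 'M[R]_N).

Lemma poly_mx_eigenr (c : 'cV_N) x p :
  A *m c = x *: c -> poly_mx A p *m c = p.[x] *: c.
Proof.
move=> Ac; rewrite /poly_mx mulmx_suml horner_coef scaler_suml.
apply: eq_bigr => i _; rewrite -scalemxAl -scalerA; congr (_ *: _).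
elim: (nat_of_ord i) => [|k IHk]; first by rewrite !expr0 mul1mx scale1r.
by rewrite !exprS -mulmxE -mulmxA IHk -scalemxAr Ac scalerA mulrC.
Qed.

Lemma poly_mx_eigenl (v : 'rV_N) x p :
  v *m A = x *: v -> v *m poly_mx A p = p.[x] *: v.
Proof.
move=> Av; rewrite /poly_mx mulmx_sumr horner_coef scaler_suml.
apply: eq_bigr => i _; rewrite -scalemxAr -scalerA; congr (_ *: _).
elim: (nat_of_ord i) => [|k IHk]; first by rewrite !expr0 mulmx1 scale1r.
by rewrite !exprSr -mulmxE mulmxA IHk -scalemxAl Av scalerA.
Qed.

End PolyMx.

Lemma poly_mx_intertwine (R : comNzRingType) N (A B C : 'M[R]_N) p :
  A *m B = B *m C -> poly_mx A p *m B = B *m poly_mx C p.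
Proof.
move=> AB; rewrite /poly_mx mulmx_suml mulmx_sumr; apply: eq_bigr => i _.
rewrite -scalemxAl -scalemxAr; congr (_ *: _).
elim: (nat_of_ord i) => [|k IHk]; first by rewrite !expr0 mul1mx mulmx1.
by rewrite !exprS -!mulmxE -mulmxA IHk !mulmxA AB.
Qed.

Lemma poly_mx_tr (R : comNzRingType) N (A : 'M[R]_N) p :
  (poly_mx A p)^T = poly_mx A^T p.
Proof.
rewrite /poly_mx raddf_sum; apply: eq_bigr => i _.
rewrite /= linearZ /=; congr (_ *: _).
elim: (nat_of_ord i) => [|k IHk]; first by rewrite !expr0 trmx1.
by rewrite exprSr exprS -!mulmxE trmx_mul IHk.
Qed.

Lemma map_poly_mx (F L : fieldType) (f : {rmorphism F -> L}) N (A : 'M[F]_N) p :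
  map_mx f (poly_mx A p) = poly_mx (map_mx f A) (map_poly f p).
Proof.
rewrite /poly_mx size_map_poly raddf_sum; apply: eq_bigr => i _.
by rewrite /= map_mxZ coef_map map_mxX.
Qed.

Lemma poly_mx_horner (R : comNzRingType) N (A : 'M[R]_N.+1) p :
  poly_mx A p = horner_mx A p.
Proof.
rewrite /poly_mx -[in RHS](coefK p) poly_def rmorph_sum; apply: eq_bigr => i _.
by rewrite /= horner_mxZ rmorphXn /= horner_mx_X.
Qed.

Lemma poly_mx_Xn_sub_1 (R : comNzRingType) N (A : 'M[R]_N) n :
  A ^+ n = 1 -> poly_mx A ('X^n - 1) = 0.
Proof.
case: N A => [|N] A An; first by rewrite thinmx0.
by rewrite poly_mx_horner rmorphB rmorph1 rmorphXn /= horner_mx_X An subrr.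
Qed.

(** * Eigenvector decompositions, and linear conditions under field extension *)

Section EigenDecomposition.
Variables (F : fieldType) (N : nat) (A : 'M[F]_N) (I : finType) (P : pred I).
Variable r : I -> F.
Hypothesis r_inj : {in P &, injective r}.

(** Since [r] is injective on [P], the linear factors are pairwise coprime, so the kernel of their
    product is the sum of their kernels, and these are eigenspaces. *)
Lemma ker_poly_mx_prod (v : 'rV_N) :
    v *m poly_mx A (\prod_(i | P i) ('X - (r i)%:P)) = 0 ->
  exists2 w : I -> 'rV_N, v = \sum_(i | P i) w i
                        & forall i, w i *m A = r i *: w i.
Proof.
move=> v0.
have: (v <= \sum_(i | P i) kermxpoly A ('X - (r i)%:P))%MS.
  rewrite -kermxpoly_prod; last first.
    move=> i j Pi Pj; apply: contraNT => /negP ncop.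
    rewrite -(inj_in_eq r_inj) //; apply/eqP.
    by apply/esym/eqP; apply: contra_notT ncop => ne; rewrite coprimep_XsubC2 // subr_eq0 eq_sym.
  case: N A v v0 => [|N'] A' v v0; first by rewrite (thinmx0 v) sub0mx.
  apply/sub_kermxP; rewrite -[RHS]v0; congr (_ *m _).
  by rewrite poly_mx_horner.
case/sub_sumsmxP => u ->; exists (fun i => u i *m kermxpoly A ('X - (r i)%:P)) => // i.
by apply/eigenspaceP; rewrite eigenspace_poly submxMl.
Qed.
End EigenDecomposition.

Section Descent.
Variables (F L : fieldType) (f : {rmorphism F -> L}) (N : nat).

(** The columns of [1 - projv V] annihilate [V]. If they annihilate [a] as well, then [a] is fixed
    by the projection onto [V]. *)
Lemma vspace_separation (V : {vspace 'rV[F]_N}) (a : 'rV[F]_N) :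
  (forall c : 'cV_N, (forall v, v \in V -> v *m c = 0) -> a *m c = 0) ->
  a \in V.
Proof.
move=> aV; pose M : 'M[F]_N := 1%:M - lin1_mx (projv V).
have ME x : x *m M = x - projv V x by rewrite mulmxBr mulmx1 mul_rV_lin1.
suff /eqP: a *m M = 0 by rewrite ME subr_eq0 => /eqP ->; apply: memv_proj.
apply/rowP => j; have: a *m col j M = 0.
  by apply: aV => v Vv; rewrite colE mulmxA ME projv_id // subrr mul0mx.
by rewrite colE mulmxA -colE => /colP /(_ 0); rewrite !mxE.
Qed.

(** By separation over [F], the row [a] is an [F]-combination of [S]; this relation survives the
    passage to [L]. *)
Lemma annihilator_descent (S : seq 'rV[F]_N) (a : 'rV[F]_N) (c : 'cV[L]_N) :
    (forall b : 'cV[F]_N, {in S, forall s, s *m b = 0} -> a *m b = 0) ->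
    {in S, forall s, map_mx f s *m c = 0} ->
  map_mx f a *m c = 0.
Proof.
move=> aS Sc; have /coord_span ->: a \in <<in_tuple S>>%VS.
  by apply: vspace_separation => b Vb; apply: aS => s Ss; apply/Vb/memv_span.
rewrite raddf_sum mulmx_suml big1 // => i _.
by rewrite /= map_mxZ -scalemxAl Sc ?scaler0 // mem_nth.
Qed.

(* [p / ('X - z)] has coefficients [(drop_poly i.+1 p).[z]]. *)
Lemma annihilator_irreducible (p : {poly F}) (z : L) (A : 'M[F]_N)
    (S : seq 'rV[F]_N) (a : 'rV[F]_N) (c : 'cV[F]_N) :
    p != 0 -> root (map_poly f p) z ->
    (forall q : {poly F}, (size q < size p)%N -> root (map_poly f q) z -> q = 0) ->
    poly_mx A p *m c = 0 ->
    {in S, forall s i, s *m A ^+ i *m c = 0} ->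
    (forall b : 'cV[L]_N, {in S, forall s, map_mx f s *m b = 0} ->
       map_mx f A *m b = z *: b -> map_mx f a *m b = 0) ->
  a *m c = 0.
Proof.
move=> p_neq0 pz0 p_min pAc Sc aH.
pose g i : L := (map_poly f (drop_poly i p)).[z].
have g0 : g 0%N = 0 by rewrite /g drop_poly0l; apply/rootP.
(* This is the Horner recurrence; together with [g 0 = p(z) = 0] it makes the sum for [(A - z) b]
   telescope. *)
have gS i : g i = g i.+1 * z + f p`_i.
  rewrite /g; have -> : drop_poly i p = drop_poly i.+1 p * 'X + (p`_i)%:P.
    apply/polyP => [[|k]]; rewrite !coefE /= ?add0r ?addr0 //.
    by rewrite addSnnS.
  by rewrite rmorphD rmorphM /= map_polyX map_polyC /= !hornerE.
pose v i : 'cV[L]_N := map_mx f (A ^+ i *m c).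
(* This is [(p / (X - z))(A) c], the test column to which [aH] is applied. *)
pose b := \sum_(i < size p) g i.+1 *: v i.
have Sb s : (forall i, s *m A ^+ i *m c = 0) -> map_mx f s *m b = 0.
  move=> sc; rewrite mulmx_sumr big1 // => i _.
  by rewrite -scalemxAr -map_mxM mulmxA sc map_mx0 scaler0.
(* The i-th term of [(A - z) b] is a difference of consecutive [g i *: v i] plus [p_i A^i c]. The
   differences telescope to 0, because [g] vanishes at 0 and at [size p], and the remaining terms
   add up to [p(A) c = 0]. *)
have Ab : map_mx f A *m b = z *: b.
  apply/eqP; rewrite -subr_eq0 mulmx_sumr scaler_sumr -sumrB.
  have E (i : 'I_(size p)) : true ->
      map_mx f A *m (g i.+1 *: v i) - z *: (g i.+1 *: v i)
      = (g i.+1 *: v i.+1 - g i *: v i) + map_mx f (p`_i *: (A ^+ i *m c)).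
    move=> _; rewrite -scalemxAr -map_mxM mulmxA mulmxE -exprS scalerA.
    rewrite map_mxZ -/(v i) -/(v i.+1) (gS i) -addrA scalerDl opprD mulrC.
    by rewrite -(addrA (- _)) addNr addr0.
  rewrite (eq_bigr _ E) big_split /= -raddf_sum.
  have -> : \sum_(i < size p) p`_i *: (A ^+ i *m c) = 0.
    rewrite -[RHS]pAc mulmx_suml; apply: eq_bigr => i _.
    by rewrite -scalemxAl.
  rewrite raddf0 addr0 -(big_mkord xpredT (fun i => g i.+1 *: v i.+1 - g i *: v i)).
  rewrite telescope_sumr // g0 scale0r subr0.
  by rewrite /g drop_poly_eq0 // rmorph0 horner0 scale0r.
have := aH b (fun s Ss => Sb _ s (Sc s Ss)) Ab.
pose t i := (a *m A ^+ i *m c) 0 0.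
move/(congr1 (fun x : 'M_1 => x 0 0)); rewrite mulmx_sumr summxE mxE => qz0.
(* The polynomial over [F] whose value at [z] is [a b], hence 0. Every summand has size below that
   of [p], so minimality of [p] forces [q = 0]. *)
pose q := \sum_(i < size p) t i *: drop_poly i.+1 p.
have q0 : q = 0.
  apply: p_min; last first.
    rewrite /root -[X in _ == X]qz0 raddf_sum horner_sum; apply/eqP.
    apply: eq_bigr => i _; rewrite /= map_polyZ hornerZ -scalemxAr mxE mulrC.
    by rewrite /v -map_mxM mulmxA [in RHS]mxE.
  have sz : (0 < size p)%N by rewrite size_poly_gt0.
  apply: leq_ltn_trans (size_sum _ _ _) _; rewrite -(ltn_predK sz) ltnS.
  apply/bigmax_leqP => i _; apply: leq_trans (size_scale_leq _ _) _.
  by rewrite size_drop_poly (leq_trans (leq_sub2l _ (ltn0Sn i))) // subn1.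
have sz : (1 < size p)%N.
  by rewrite -(size_map_poly f); apply: root_size_gt1 pz0; rewrite map_poly_eq0.
have [n sn] : exists n, size p = n.+2.
  by case: (size p) sz => [|[|n]] // _; exists n.
(* Here [n.+1] is the degree of [p]. In degree [n] only the summand [i = 0] contributes, with
   coefficient [t 0 * lead_coef p], and [t 0] is the entry of [a c]. *)
have: q`_n = 0 by rewrite q0 coef0.
rewrite coef_sum (bigD1 (Ordinal (ltnW sz))) //= big1 => [|i i_neq0]; last first.
  rewrite coefZ coef_drop_poly nth_default ?mulr0 //.
  apply: (@leq_trans n.+2); first by rewrite sn.
  by rewrite addnS ltnS -addn1 leq_add2l lt0n.
rewrite addr0 coefZ coef_drop_poly addn1 => /eqP.
have -> : p`_n.+1 = lead_coef p by rewrite lead_coefE sn.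
rewrite mulf_eq0 lead_coef_eq0 (negPf p_neq0) orbF => /eqP t0.
by rewrite [LHS]mx11_scalar; move: t0; rewrite /t expr0 mulmx1 => ->; rewrite raddf0.
Qed.
End Descent.

(** * Cyclotomic polynomials and primitive roots of unity *)

Lemma map_Cyclotomic (F : fieldType) (d : nat) (z : F) :
  d.-primitive_root z -> map_poly intr 'Phi_d = cyclotomic z d.
Proof.
elim/ltn_ind: d z => d IHd z prim_z; have d_gt0 := prim_order_gt0 prim_z.
have [uD _ inD] := divisors_correct d_gt0.
have /esym := prod_cyclotomic prim_z.
have -> : 'X^d - 1 = map_poly intr ('X^d - 1) :> {poly F}.
  by rewrite rmorphB rmorph1 /= map_polyXn.
(* Both sides now factor [X^d - 1] over the divisors of [d]. The factors of proper divisors agree by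
   induction, and their product is monic, so it cancels. *)
rewrite -prod_Cyclotomic // rmorph_prod /= (big_rem d) ?inD //=.
rewrite [X in _ = X](big_rem d) ?inD //=.
rewrite divnn d_gt0 expr1 [X in _ = _ * X](eq_big_seq (fun e => cyclotomic (z ^+ (d %/ e)) e)).
  move/mulIf => -> //; apply/monic_neq0/monic_prod => e _.
  exact: cyclotomic_monic.
move=> e; rewrite mem_rem_uniq // !inE inD => /andP[e_neq ed].
by apply: IHd; rewrite ?dvdn_prim_root // ltn_neqAle e_neq dvdn_leq.
Qed.

(** The polynomial is the minimal polynomial over the rationals of a primitive root [z] in [algC].
    In a factorisation [r * q] one factor vanishes at [z] and is thus divisible by the whole
    product; if that factor is [r], then [q] is constant. *)
Lemma Cyclotomic_irreducible d : (0 < d)%N ->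
  irreducible_poly (map_poly intr 'Phi_d : {poly rat}).
Proof.
move=> d_gt0; have [z prim_z] := C_prim_root_exists d_gt0.
have [p [Dp mon_p] dv_p] := minCpolyP z.
have -> : map_poly intr 'Phi_d = p.
  apply: (map_poly_inj (@ratr algC)).
  rewrite -Dp (minCpoly_cyclotomic prim_z) -(map_Cyclotomic prim_z).
  by rewrite -map_poly_comp; apply: eq_map_poly => b; rewrite /= rmorph_int.
have p_gt1 : (1 < size p)%N by rewrite -(size_map_poly (@ratr algC)) -Dp size_minCpoly.
split=> // q q_neq1 /dvdpP[r Dr]; rewrite /eqp Dr dvdp_mull //=.
have p_neq0 := monic_neq0 mon_p.
have : root (map_poly ratr (r * q)) z by rewrite dv_p -Dr.
rewrite rmorphM rootM !dv_p => /orP[p_r|]; last by rewrite -Dr.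
have [q0 r0] : q != 0 /\ r != 0.
  by move: p_neq0; rewrite Dr mulf_eq0 negb_or => /andP[-> ->].
have := dvdp_leq r0 p_r; rewrite Dr size_mul // => szr.
case/negP: q_neq1; move: q0; rewrite -size_poly_gt0.
case: (size q) szr => [|[|k]] //; by rewrite !addnS /= ltnNge leq_addr.
Qed.

(** A nonzero [q] would share the root [z] with [p], so their gcd would be nonconstant, hence
    associate to [p], and [p] would divide the smaller [q]. *)
Lemma irreducible_root_small (F L : fieldType) (f : {rmorphism F -> L})
    (p q : {poly F}) (z : L) :
    irreducible_poly p -> root (map_poly f p) z ->
  (size q < size p)%N -> root (map_poly f q) z -> q = 0.
Proof.
move=> [p_gt1 p_irr] pz sz_q qz; apply/eqP/contraT => q_neq0.
have g_root : root (map_poly f (gcdp q p)) z by rewrite gcdp_map root_gcd pz qz.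
have g_neq0 : gcdp q p != 0 by rewrite gcdp_eq0 negb_and q_neq0.
have g_gt1 : (1 < size (gcdp q p))%N.
  by rewrite -(size_map_poly f); apply: root_size_gt1 g_root; rewrite map_poly_eq0.
have /eqp_size szg : gcdp q p %= p.
  by apply: p_irr (dvdp_gcdr _ _); rewrite gtn_eqF.
by have := dvdp_leq q_neq0 (dvdp_gcdl q p); rewrite szg leqNgt sz_q.
Qed.

Lemma prim_rootV (F : fieldType) d (z : F) :
  d.-primitive_root z -> d.-primitive_root z^-1.
Proof.
move=> z_prim; have d_gt0 := prim_order_gt0 z_prim.
have -> : z^-1 = z ^+ d.-1.
  apply: (mulfI (x := z)); first by rewrite (prim_root_eq0 z_prim) -lt0n.
  by rewrite -exprS prednK // (prim_expr_order z_prim) divff // (prim_root_eq0 z_prim) -lt0n.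
by rewrite prim_root_exp_coprime // coprimePn.
Qed.

Lemma prim_root_exists (F : numClosedFieldType) n :
  (0 < n)%N -> exists z : F, n.-primitive_root z.
Proof.
move=> n_gt0; have [r Dr] := closed_field_poly_normal ('X^n - 1 : {poly F}).
rewrite (monicP (monicXnsubC _ n_gt0)) scale1r in Dr.
have /hasP[z _ prim_z] : has n.-primitive_root r; last by exists z.
apply: has_prim_root => //.
- by apply/allP => z; rewrite -root_prod_XsubC -Dr.
- by rewrite -separable_prod_XsubC -Dr separable_Xn_sub_1 // pnatr_eq0 -lt0n.
- by rewrite -ltnS -(size_prod_XsubC r id) -Dr size_XnsubC.
Qed.

Lemma cyclotomic_prim_root (R : realType) n (K : splittingFieldType rat)
    (iota : {rmorphism K -> R[i]}) :
  (0 < n)%N -> is_cyclotomic n iota -> exists w : K, n.-primitive_root w.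
Proof.
move=> n_gt0 [s sP _]; have [z prim_z] := prim_root_exists R[i] n_gt0.
have := sP z; rewrite unity_rootE (prim_expr_order prim_z) eqxx.
case/mapP => w _ Dz; exists w; move: prim_z; rewrite Dz.
by rewrite fmorph_primitive_root.
Qed.

(** * Sums of subspaces over possibly infinite index sets *)

Section FsbigAddv.
Variables (F : fieldType) (V : vectType F) (I : choiceType).
Variables (D : set I) (U : I -> {vspace V}).

Lemma fsbig_addv_sub (W : {vspace V}) :
  (forall i, D i -> (U i <= W)%VS) ->
  (\big[@addv F V / 0%VS]_(i \in D) U i <= W)%VS.
Proof.
(* With infinite support the sum takes the default value 0, which lies in [W]. *)
move=> UW; case: finite_supportP => [_|S SD _ _]; first by rewrite big_nil sub0v.
rewrite big_seq; apply: (big_ind (fun U' => U' <= W)%VS) => [|U1 U2 U1W U2W|i Si].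
- exact: sub0v.
- by rewrite subv_add U1W.
- exact/UW/SD.
Qed.

Lemma fsbig_addv_sup i :
  finite_set (D `&` U @^-1` [set~ 0%VS])%classic -> D i ->
  (U i <= \big[@addv F V / 0%VS]_(j \in D) U j)%VS.
Proof.
move=> finU Di; case: finite_supportP => [/(_ finU) //|S _ U0 _].
have [Si|Si] := boolP (i \in S); last by rewrite U0 // sub0v.
by rewrite (big_rem i) //= addvSl.
Qed.
End FsbigAddv.

(** * The matrix of phi and its eigenspaces over K *)

Lemma base_change_endE (F : fieldType) (X : vectType int) (f : 'End(X))
    (v : 'rV[F]_(dim X)) :
  base_change_end F f v = v *m map_mx intr (f2mx f).
Proof. by rewrite lfunE. Qed.

Lemma f2mx_exp (X : vectType int) (f : 'End(X)) n :
  (forall x, iter n f x = x) -> f2mx f ^+ n = 1.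
Proof.
move=> fn; apply/row_matrixP => i; rewrite !rowE mulmx1.
set v := delta_mx 0 i.
have E k u : v2r (iter k f u) = v2r u *m f2mx f ^+ k.
  elim: k => [|k IHk]; first by rewrite expr0 mulmx1.
  by rewrite iterS exprSr -mulmxE mulmxA -IHk unlock /= r2vK.
by have := E n (r2v v); rewrite fn r2vK => <-.
Qed.

Section Eigenspaces.
Variables (R : realType) (K : splittingFieldType rat).
Variable iota : {rmorphism K -> R[i]}.
Variables (X : vectType int) (phi : 'End(X)).
Let A : 'M[K]_(dim X) := map_mx intr (f2mx phi).

Lemma mem_eigenspaceK (x : K) v :
  (v \in eigenspaceK iota phi (iota x)) = (v *m A == x *: v).
Proof.
rewrite /eigenspaceK; case: pselect => [zK|[]]; last by exists x.
case: cid => y /= /fmorph_inj ->.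
by rewrite memv_ker add_lfunE opp_lfunE scale_lfunE id_lfunE base_change_endE subr_eq0.
Qed.

Lemma eigenspaceK_out (zeta : R[i]) :
  ~ (exists z, iota z = zeta) -> eigenspaceK iota phi zeta = 0%VS.
Proof. by rewrite /eigenspaceK; case: pselect. Qed.

Variables (n : nat) (w : K).
Hypotheses (phi_n : forall x, iter n phi x = x) (w_prim : n.-primitive_root w).

Let n_gt0 := prim_order_gt0 w_prim.

Let An : A ^+ n = 1.
Proof. by rewrite -map_mxX f2mx_exp // map_mx1. Qed.

(** A nonzero eigenvector is fixed by [A ^+ n = 1], so its eigenvalue is an n-th root of unity. This
    gives the sums of eigenspaces indexed by [R[i]] finite support. *)
Lemma eigenspaceK_neq0 (xi : R[i]) : eigenspaceK iota phi xi <> 0%VS ->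
  exists i : 'I_n, xi = iota (w ^+ i).
Proof.
have [[x <-] /eqP|/eigenspaceK_out //] := pselect (exists x, iota x = xi).
rewrite -vpick0 => v_neq0; have := memv_pick (eigenspaceK iota phi (iota x)).
rewrite mem_eigenspaceK; set v := vpick _ in v_neq0 * => /eqP vA.
suff /(prim_rootP w_prim) [i ->] : x ^+ n = 1 by exists i.
have E k : v *m A ^+ k = x ^+ k *: v.
  elim: k => [|k IHk]; first by rewrite mulmx1 scale1r.
  by rewrite !exprSr -mulmxE mulmxA IHk -scalemxAl vA scalerA.
have /eqP := E n; rewrite An mulmx1 -subr_eq0 -{1}[v]scale1r -scalerBl.
by rewrite scaler_eq0 (negPf v_neq0) orbF subr_eq0 => /eqP.
Qed.

Lemma finite_eigenspaceK (D : set R[i]) :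
  finite_set (D `&` eigenspaceK iota phi @^-1` [set~ 0%VS])%classic.
Proof.
apply: sub_finite_set (finite_seq [seq iota (w ^+ (i : 'I_n)) | i <- enum 'I_n]).
by move=> xi [_ /= /eigenspaceK_neq0[i ->]]; apply/mapP; exists i; rewrite ?mem_enum.
Qed.

Lemma prim_expr_inj : injective (fun i : 'I_n => w ^+ i).
Proof.
move=> i j /eqP; rewrite (eq_prim_root_expr w_prim).
by rewrite !modn_small // => /eqP /val_inj.
Qed.

(** [A] is killed by [X^n - 1], which splits over [K] into the distinct factors [X - w^i]. *)
Lemma eigenspaceK_decomposition (v : 'rV[K]_(dim X)) :
  exists2 u : 'I_n -> 'rV[K]_(dim X), v = \sum_i u i
    & forall i, u i *m A = w ^+ i *: u i.
Proof.
apply: (@ker_poly_mx_prod K (dim X) A 'I_n xpredT (fun i => w ^+ i)).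
  exact: in2W prim_expr_inj.
rewrite -(big_mkord xpredT (fun i => 'X - (w ^+ i)%:P)) factor_Xn_sub_1 //.
by rewrite poly_mx_Xn_sub_1 ?mulmx0.
Qed.

End Eigenspaces.

(** * The eigenspace projector *)

Section EigenProjection.
Variables (R : realType) (K : splittingFieldType rat).
Variable iota : {rmorphism K -> R[i]}.
Variables (X : vectType int) (phi : 'End(X)) (n : nat) (w : K).
Hypotheses (phi_n : forall x, iter n phi x = x) (w_prim : n.-primitive_root w).
Let A : 'M[K]_(dim X) := map_mx intr (f2mx phi).
Variable z : K.
Let U := eigenspaceK iota phi (iota z).
Let V := (\big[@addv K 'rV[K]_(dim X) / 0%VS]_(xi \in [set xi | xi != iota z]%classic)
           eigenspaceK iota phi xi)%VS.

Let eigenvector_sub (x : K) u : x != z -> u *m A = x *: u -> u \in V.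
Proof.
move=> x_neq uA; have := fsbig_addv_sup (D := [set xi | xi != iota z]%classic)
  (finite_eigenspaceK iota phi_n w_prim _) (i := iota x).
rewrite /= fmorph_eq => /(_ x_neq) /subvP; apply.
by rewrite mem_eigenspaceK uA.
Qed.

Let eigenspaces_full v : v \in (U + V)%VS.
Proof.
have [u -> uA] := eigenspaceK_decomposition phi_n w_prim v.
apply: rpred_sum => i _; have [wz|wz] := eqVneq (w ^+ i) z.
  by apply: (subvP (addvSl _ _)); rewrite mem_eigenspaceK uA wz.
exact: (subvP (addvSr _ _)) (eigenvector_sub wz (uA i)).
Qed.

(** The product [h] of the [X - w^i] with [w^i != z] gives a matrix [h(A)] that kills [V] and acts
    on [U] as the nonzero scalar [h(z)]. *)
Let eigenspaces_disjoint : (U :&: V = 0)%VS.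
Proof.
apply/eqP; rewrite -subv0; apply/subvP => v; rewrite memv_cap memv0.
rewrite mem_eigenspaceK => /andP[/eqP vA].
pose h := \prod_(i < n | w ^+ i != z) ('X - (w ^+ i)%:P).
have Vh : (V <= lker (linfun (mulmxr (poly_mx A h))))%VS.
  apply: fsbig_addv_sub => xi /= xi_neq; apply/subvP => u.
  have [->|/eqP/eigenspaceK_neq0] := eqVneq (eigenspaceK iota phi xi) 0%VS.
    by rewrite memv0 => /eqP ->; rewrite mem0v.
  move=> /(_ n w phi_n w_prim) [i Dxi].
  rewrite Dxi mem_eigenspaceK => /eqP uA; rewrite memv_ker lfunE /=.
  rewrite (poly_mx_eigenl _ uA) horner_prod (bigD1 i) /=.
    by rewrite !hornerE subrr mul0r scale0r.
  by move: xi_neq; rewrite Dxi fmorph_eq.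
move/(subvP Vh); rewrite memv_ker lfunE /= (poly_mx_eigenl _ vA) scaler_eq0.
case/orP => //; rewrite horner_prod => /prodf_eq0 [i wz].
by rewrite !hornerE subr_eq0 eq_sym (negPf wz).
Qed.

Let eigen_projV v : v \in V -> eigen_proj iota phi (iota z) v = 0.
Proof.
move=> Vv; have UV := eigenspaces_disjoint.
have := daddv_pi_add UV (eigenspaces_full v).
rewrite (daddv_pi_id _ Vv) ?[(V :&: U)%VS]capvC //.
by move=> E; apply: (addIr v); rewrite add0r.
Qed.

(** The kernel [V] of theta is the row image of [A - z], so the preimage is the sum of [S] and that
    image. A column annihilates the image exactly when it is a right eigenvector of [A] for [z];
    separation then turns membership into a condition on such columns. *)
Lemma mem_eigen_proj_preim (S : {vspace 'rV[K]_(dim X)}) a :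
  let theta := eigen_proj iota phi (iota z) in
  a \in (theta @^-1: (theta @: S))%VS <->
  (forall c : 'cV_(dim X), (forall s, s \in S -> s *m c = 0) ->
     A *m c = z *: c -> a *m c = 0).
Proof.
move=> theta; split=> [|aS].
  rewrite -memv_preim => /memv_imgP[s Ss theta_as] c Sc Ac.
  have Vas : a - s \in V.
    have := daddv_pi_add eigenspaces_disjoint (eigenspaces_full (a - s)).
    rewrite -/(eigen_proj iota phi (iota z)) -/theta linearB /= theta_as subrr add0r => <-.
    exact: memv_pi.
  have Vc : (V <= lker (linfun (mulmxr c)))%VS.
    apply: fsbig_addv_sub => xi /= xi_neq; apply/subvP => u.
    have [[x Dx]|/(eigenspaceK_out _) ->] := pselect (exists x, iota x = xi); last first.
      by rewrite memv0 => /eqP ->; rewrite mem0v.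
    rewrite -Dx mem_eigenspaceK => /eqP uA; rewrite memv_ker lfunE /=.
    have : u *m A *m c = z *: (u *m c) by rewrite -mulmxA Ac scalemxAr.
    rewrite uA -scalemxAl => /eqP; rewrite -subr_eq0 -scalerBl scaler_eq0.
    by rewrite subr_eq0 -(fmorph_eq iota) Dx (negPf xi_neq).
  move/(subvP Vc): Vas; rewrite memv_ker lfunE /= mulmxBl (Sc _ Ss) subr0.
  by move/eqP.
have : a \in (S + limg (linfun (mulmxr (A - z%:M))))%VS.
  apply: vspace_separation => c Sc; apply: aS => [s Ss|].
    exact/Sc/(subvP (addvSl _ _)).
  apply/row_matrixP => i; apply/eqP; rewrite -subr_eq0 -linearB /=.
  rewrite -mul_scalar_mx -mulmxBl rowE mulmxA; apply/eqP/Sc.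
  apply: (subvP (addvSr _ _)); apply/memv_imgP.
  by exists (delta_mx 0 i); rewrite ?memvf ?lfunE.
case/memv_addP => s Ss [_ /memv_imgP[y _ ->] ->].
rewrite -memv_preim linearD /= lfunE; apply: memvD; first exact: memv_img.
rewrite [X in X \in _]eigen_projV ?mem0v //=.
have [u -> uA] := eigenspaceK_decomposition phi_n w_prim y.
rewrite mulmx_suml; apply: rpred_sum => i _; rewrite mulmxBr uA mul_mx_scalar.
rewrite -scalerBl; have [->|wz] := eqVneq (w ^+ i) z.
  by rewrite subrr scale0r mem0v.
exact/memvZ/(eigenvector_sub wz).
Qed.
End EigenProjection.

(** * Rational annihilators and the invariant form *)

Lemma annihilator_vspace (F : fieldType) N (B : 'M[F]_N) (S : seq 'rV[F]_N) :
  exists E : {vspace 'rV[F]_N},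
    forall e, e \in E <-> {in S, forall s, s *m B *m e^T = 0}.
Proof.
elim: S => [|s S [E EP]]; first by exists fullv => e; rewrite memvf.
exists (lker (linfun (mulmxr (s *m B)^T)) :&: E)%VS => e.
have Es : (e *m (s *m B)^T == 0) = (s *m B *m e^T == 0).
  by rewrite -(inj_eq trmx_inj) trmx_mul trmxK trmx0.
rewrite memv_cap memv_ker lfunE /= Es; split.
  by case/andP=> /eqP se /EP Ee t; rewrite inE => /predU1P[-> //|/Ee].
move=> Se; apply/andP; split; first by apply/eqP/Se; rewrite inE eqxx.
by apply/EP => t St; apply: Se; rewrite inE St orbT.
Qed.

(* The vectors [c] with [p(A) c = 0] and [s A^i c = 0] for all [s] in [S] and
   all [i], as the annihilator of finitely many rows when [A^n = 1]. *)
Definition krylov_rows (F : fieldType) N n (A : 'M[F]_N) p (S : seq 'rV[F]_N) :=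
  [seq row i (poly_mx A p) | i <- enum 'I_N]
  ++ [seq s *m A ^+ i | s <- S, i <- iota 0 n].

Lemma krylov_rowsP (F : fieldType) N n (A : 'M[F]_N) p (S : seq 'rV[F]_N)
    (c : 'cV_N) :
    (0 < n)%N -> A ^+ n = 1 ->
  {in krylov_rows n A p S, forall t, t *m c = 0} <->
  poly_mx A p *m c = 0 /\ {in S, forall s i, s *m A ^+ i *m c = 0}.
Proof.
move=> n_gt0 An; split=> [Tc|[pc Sc] t].
  split=> [|s Ss i].
    apply/row_matrixP => i; rewrite row_mul row0 Tc //.
    by rewrite mem_cat; apply/orP; left; apply/mapP; exists i; rewrite ?mem_enum.
  have -> : A ^+ i = A ^+ (i %% n).
    by rewrite {1}(divn_eq i n) exprD mulnC exprM An expr1n mul1r.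
  rewrite Tc // mem_cat; apply/orP; right.
  by apply/allpairsP; exists (s, i %% n)%N; rewrite mem_iota ltn_mod n_gt0.
rewrite mem_cat => /orP[/mapP[i _ ->]|/allpairsP[[s i] /= [Ss _ ->]]].
  by rewrite -row_mul pc row0.
exact: Sc.
Qed.

Section RationalForm.
Variables (N n : nat) (A B : 'M[rat]_N).
Hypotheses (n_gt0 : (0 < n)%N) (An : A ^+ n = 1).
Hypotheses (B_pos : forall x : 'rV_N, x != 0 -> 0 < (x *m B *m x^T) 0 0)
  (B_inv : A *m B *m A^T = B).

Lemma form_unitmx : B \in unitmx.
Proof.
rewrite -row_free_unit; apply/inj_row_free => v vB.
apply/eqP/contraT => /B_pos.
by rewrite vB mul0mx mxE ltxx.
Qed.

(** Identifies columns, on which the linear conditions are imposed, with vectors [e] of X_Q. *)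
Lemma form_surj (c : 'cV_N) : exists e : 'rV_N, c = B *m e^T.
Proof.
exists (invmx B *m c)^T; rewrite trmxK mulmxA mulmxV ?mul1mx //.
exact: form_unitmx.
Qed.

Let An1 : A *m A ^+ n.-1 = 1.
Proof. by rewrite mulmxE -exprS prednK. Qed.

Let n1A : A ^+ n.-1 *m A = 1.
Proof. by rewrite mulmxE -exprSr prednK. Qed.

(** Invariance says that the adjoint of [A] is its inverse, written [A ^+ n.-1] so that only
    nonnegative powers occur. *)
Lemma form_adjoint : A *m B = B *m (A ^+ n.-1)^T.
Proof.
rewrite -{2}B_inv -mulmxA -trmx_mul n1A.
by rewrite trmx1 mulmx1.
Qed.

Lemma form_adjoint_exp i : A ^+ i *m B = B *m (A ^+ n.-1 ^+ i)^T.
Proof.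
elim: i => [|i IHi]; first by rewrite !expr0 trmx1 mul1mx mulmx1.
by rewrite exprS -mulmxE -mulmxA IHi mulmxA form_adjoint -mulmxA -trmx_mul mulmxE -exprSr.
Qed.

End RationalForm.

(** * From eigenvectors over K to rational columns *)

Section Closure.
Variables (K : fieldType) (h : {rmorphism rat -> K}).
Variables (N n : nat) (A : 'M[rat]_N) (d : nat) (z : K).
Hypotheses (n_gt0 : (0 < n)%N) (An : A ^+ n = 1) (z_prim : d.-primitive_root z).
Let p : {poly rat} := map_poly intr 'Phi_d.

Lemma map_Cyclotomic_rat x : d.-primitive_root x -> map_poly h p = cyclotomic x d.
Proof.
move=> x_prim; rewrite -map_poly_comp -(map_Cyclotomic x_prim).
by apply: eq_map_poly => b; rewrite /= rmorph_int.
Qed.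

Lemma root_Cyclotomic_rat x : d.-primitive_root x -> root (map_poly h p) x.
Proof. by move=> x_prim; rewrite (map_Cyclotomic_rat x_prim) root_cyclotomic. Qed.

Lemma eigen_annihilatorP (S : seq 'rV[rat]_N) (a : 'rV[rat]_N) :
  (forall c : 'cV[K]_N, {in S, forall s, map_mx h s *m c = 0} ->
     map_mx h A *m c = z *: c -> map_mx h a *m c = 0) <->
  (forall c : 'cV[rat]_N, poly_mx A p *m c = 0 ->
     {in S, forall s i, s *m A ^+ i *m c = 0} -> a *m c = 0).
Proof.
have d_gt0 := prim_order_gt0 z_prim.
have pz := root_Cyclotomic_rat z_prim.
have p_irr := Cyclotomic_irreducible d_gt0.
split=> aS c.
  move=> pc Sc; apply: (annihilator_irreducible _ pz) aS => //.
    by rewrite -size_poly_gt0 (ltn_trans _ p_irr.1).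
  move=> q; exact: irreducible_root_small p_irr pz.
(* The rational conditions on a column amount to finitely many rows. They hold for the eigenvector
   [c] over [K], since [p(A) c = p(z) c = 0] and [s A^i c = z^i s c = 0], so descent applies. *)
move=> Sc Ac; apply: (annihilator_descent (S := krylov_rows n A p S)).
  by move=> b /(krylov_rowsP _ _ _ n_gt0 An)[]; apply: aS.
have AK i : map_mx h A ^+ i *m c = z ^+ i *: c.
  elim: i => [|i IHi]; first by rewrite mul1mx scale1r.
  by rewrite exprS -mulmxE -mulmxA IHi -scalemxAr Ac scalerA -exprSr.
move=> t; rewrite mem_cat => /orP[/mapP[i _ ->]|/allpairsP[[s i] /= [Ss _ ->]]].
  rewrite map_row -row_mul map_poly_mx (poly_mx_eigenr _ Ac) (rootP pz).
  by rewrite scale0r row0.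
by rewrite map_mxM map_mxX -mulmxA AK -scalemxAr Sc // scaler0.
Qed.

End Closure.

(** * Rational description of the perpendicular roots and of X_Q(phi, d) *)

Lemma base_change_rat (K : splittingFieldType rat) (X : vectType int) (a : X) :
  base_change K a = map_mx (in_alg K) (base_change rat a).
Proof. by apply/matrixP => i j; rewrite !mxE rmorph_int. Qed.

Lemma mem_roots_perp (K : splittingFieldType rat) (X : vectType int)
    (B : 'M[rat]_(dim X)) (Phi : {fset X}) (E : {vspace 'rV[rat]_(dim X)}) a :
  let EK := [set XQ_to_XK K e | e in [set e | e \in E]]%classic in
  a \in roots_perp B Phi EK <->
  a \in Phi /\ {in E, forall e, base_change rat a *m (B *m e^T) = 0}.
Proof.
move=> EK.
have fE e : (formK B (base_change K a) (XQ_to_XK K e) == 0)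
            = (base_change rat a *m (B *m e^T) == 0).
  rewrite /formK base_change_rat /XQ_to_XK map_trmx -!map_mxM mxE fmorph_eq0.
  rewrite -mulmxA; apply/eqP/eqP => [e0|->]; last by rewrite mxE.
  by rewrite [LHS]mx11_scalar e0 raddf0.
rewrite !inE /=; split.
  case/andP=> -> /set_mem aE; split=> // e Ee; apply/eqP; rewrite -fE; apply/eqP/aE.
  by exists e.
case=> -> aE /=; apply/mem_set => _ [e /= Ee <-].
by apply/eqP; rewrite fE aE.
Qed.

Section SplitLevi.
Variables (R : realType) (K : splittingFieldType rat).
Variable iota : {rmorphism K -> R[i]}.
Variables (X : vectType int) (phi : 'End(X)) (n : nat) (w : K).
Hypotheses (phi_n : forall x, iter n phi x = x) (w_prim : n.-primitive_root w).
Variable B : 'M[rat]_(dim X).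
Let A : 'M[rat]_(dim X) := map_mx intr (f2mx phi).
Hypotheses
  (B_pos : forall x : 'rV[rat]_(dim X), x != 0 -> 0 < (x *m B *m x^T) 0 0)
  (B_inv : A *m B *m A^T = B).
Variables (d : nat) (z : K).
Hypothesis z_prim : d.-primitive_root z.
Let p : {poly rat} := map_poly intr 'Phi_d.
Let n_gt0 := prim_order_gt0 w_prim.

Let An : A ^+ n = 1.
Proof. by rewrite -map_mxX f2mx_exp // map_mx1. Qed.

Let AK_E : map_mx (in_alg K) A = map_mx intr (f2mx phi).
Proof. by apply/matrixP => i j; rewrite !mxE rmorph_int. Qed.

Let AKn : (map_mx (in_alg K) A) ^+ n = 1.
Proof. by rewrite -map_mxX An map_mx1. Qed.

(** Moving [p(A)] across the form gives [e p(A^-1) = 0], so over [K] the row [e] is a sum of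
    eigenvectors of [A^-1] for primitive d-th roots of unity. These are eigenvectors of [A] for the
    inverse roots, which are again primitive. *)
Lemma poly_mx_eigenspace_ord (e : 'rV[rat]_(dim X)) :
  poly_mx A p *m (B *m e^T) = 0 -> XQ_to_XK K e \in eigenspace_ord iota phi d.
Proof.
move=> pe; have B_unit := form_unitmx B_pos.
have eA : e *m poly_mx (A ^+ n.-1) p = 0.
  apply: trmx_inj; rewrite trmx0 trmx_mul poly_mx_tr.
  apply: (can_inj (mulKmx B_unit)).
  by rewrite mulmx0 mulmxA -(poly_mx_intertwine _ (form_adjoint n_gt0 An B_inv)) -mulmxA.
have [u -> uA] : exists2 u : 'I_d -> 'rV[K]_(dim X),
    XQ_to_XK K e = \sum_(k < d | coprime k d) u k
    & forall k, u k *m map_mx (in_alg K) A ^+ n.-1 = z ^+ k *: u k.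
  apply: ker_poly_mx_prod.
    move=> i j _ _ /eqP; rewrite (eq_prim_root_expr z_prim).
    by rewrite !modn_small // => /eqP /val_inj.
  rewrite -/(cyclotomic z d) -(map_Cyclotomic_rat (in_alg K) z_prim) -map_mxX.
  by rewrite -map_poly_mx -map_mxM eA map_mx0.
apply: rpred_sum => k co_k.
have zk_prim : d.-primitive_root (z ^+ k)^-1.
  by apply: prim_rootV; rewrite prim_root_exp_coprime.
suff /subvP: (eigenspaceK iota phi (iota (z ^+ k)^-1) <= eigenspace_ord iota phi d)%VS.
  apply; rewrite mem_eigenspaceK -AK_E.
  have zk_neq0 : z ^+ k != 0 by rewrite expf_neq0 // (prim_root_eq0 z_prim) -lt0n (prim_order_gt0 z_prim).
  apply/eqP; apply: (can_inj (scalerK zk_neq0)); rewrite scalerA divff // scale1r.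
  by rewrite scalemxAl -uA -mulmxA mulmxE -exprSr prednK // AKn mulmx1.
apply: fsbig_addv_sup; first exact: finite_eigenspaceK phi_n w_prim _.
by rewrite /= fmorph_primitive_root.
Qed.

(** If [v] is a row eigenvector of [A] for [x], then [B v^T] is a column eigenvector for [x^-1].
    When [x] is primitive of order [d], so is [x^-1], and [p(A)] kills that column. *)
Lemma eigenspace_ord_poly_mx (e : 'rV[rat]_(dim X)) :
  XQ_to_XK K e \in eigenspace_ord iota phi d -> poly_mx A p *m (B *m e^T) = 0.
Proof.
pose M := (map_mx (in_alg K) (poly_mx A p *m B))^T.
have ME v : v *m M = (map_mx (in_alg K) (poly_mx A p *m B) *m v^T)^T.
  by rewrite trmx_mul trmxK.
have Md : (eigenspace_ord iota phi d <= lker (linfun (mulmxr M)))%VS.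
  apply: fsbig_addv_sub => xi /= xi_prim; apply/subvP => v.
  have [[x Dx]|/(eigenspaceK_out _) ->] := pselect (exists x, iota x = xi); last first.
    by rewrite memv0 => /eqP ->; rewrite mem0v.
  have x_prim : d.-primitive_root x by rewrite -(fmorph_primitive_root iota) Dx.
  have x_neq0 : x != 0 by rewrite (prim_root_eq0 x_prim) -lt0n (prim_order_gt0 x_prim).
  rewrite -Dx mem_eigenspaceK -AK_E => /eqP vA; rewrite memv_ker lfunE /= ME.
  have vB : map_mx (in_alg K) A *m (map_mx (in_alg K) B *m v^T)
            = x^-1 *: (map_mx (in_alg K) B *m v^T).
    rewrite mulmxA -map_mxM (form_adjoint n_gt0 An B_inv) map_mxM -mulmxA.
    rewrite scalemxAr; congr (_ *m _); apply: (scalerI x_neq0).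
    rewrite scalerA divff // scale1r scalemxAr -linearZ /= -vA trmx_mul.
    rewrite mulmxA map_trmx -map_mxM -trmx_mul mulmxE -exprS prednK // An.
    by rewrite trmx1 map_mx1 mul1mx.
  rewrite map_mxM -mulmxA map_poly_mx (poly_mx_eigenr _ vB).
  have /rootP -> : root (map_poly (in_alg K) p) x^-1.
    exact/root_Cyclotomic_rat/prim_rootV.
  by rewrite scale0r trmx0.
move/(subvP Md); rewrite memv_ker lfunE /= ME => /eqP /(congr1 trmx).
rewrite trmxK trmx0 /XQ_to_XK map_trmx -map_mxM -mulmxA => /eqP.
by rewrite map_mx_eq0 => /eqP.
Qed.

End SplitLevi.

(** * Galois invariance, and roots of unity outside K *)

Lemma galois_act_rat (K : splittingFieldType rat) (X : vectType int)
    (e : 'rV[rat]_(dim X)) g :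
  g \in ('Gal({:K} / 1))%g -> galois_act g (XQ_to_XK K e) = XQ_to_XK K e.
Proof.
move=> gG; apply/matrixP => i j; rewrite !mxE.
by apply: (fixed_gal (sub1v _) gG); rewrite /= rpredZ ?mem1v.
Qed.

Lemma bilinear_mx_inj (F : pzRingType) N (M M' : 'M[F]_N) :
  (forall x y : 'rV_N, (x *m M *m y^T) 0 0 = (x *m M' *m y^T) 0 0) -> M = M'.
Proof.
move=> MM'; apply/matrixP => i j.
have := MM' (delta_mx 0 i) (delta_mx 0 j).
by rewrite trmx_delta -!rowE -!colE !mxE.
Qed.

Lemma eigen_proj_out (R : realType) (K : splittingFieldType rat)
    (iota : {rmorphism K -> R[i]}) (X : vectType int) (phi : 'End(X))
    (zeta : R[i]) (v : 'rV[K]_(dim X)) :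
  ~ (exists z, iota z = zeta) -> eigen_proj iota phi zeta v = 0.
Proof.
move=> zeta_out; apply/eqP; rewrite -memv0 -(eigenspaceK_out phi zeta_out).
exact: memv_pi.
Qed.

(** Each primitive d-th root of unity is a power of any other, so the image of [K] contains all of
    them or none. *)
Lemma eigenspace_ord_out (R : realType) (K : splittingFieldType rat)
    (iota : {rmorphism K -> R[i]}) (X : vectType int) (phi : 'End(X)) d
    (zeta : R[i]) :
  d.-primitive_root zeta -> ~ (exists z, iota z = zeta) ->
  eigenspace_ord iota phi d = 0%VS.
Proof.
move=> zeta_prim zeta_out; apply/eqP; rewrite -subv0; apply: fsbig_addv_sub => xi /= xi_prim.
rewrite eigenspaceK_out ?subvv // => -[x Dx]; apply: zeta_out.
have [i ->] := prim_rootP xi_prim (prim_expr_order zeta_prim).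
by exists (x ^+ i); rewrite rmorphXn Dx.
Qed.

Theorem corollary2p21 (R : realType)
    (X Xv : vectType int)
    (pairing : {bilinear X -> Xv -> int | *%R & *%R})
    (pairing_perfect : perfect pairing)
    (Phi : {fset X}) (coroot : X -> Xv)
    (Phi_root : root_system pairing Phi coroot)
    (Phi_reduced : reduced R Phi)
    (phi : 'End(X))
    (phi_norm : in_normalizer (weyl_group pairing Phi coroot) phi)
    (n : nat) (phi_order : has_order phi n)
    (K : splittingFieldType rat) (iota : {rmorphism K -> R[i]})
    (K_cyclotomic : is_cyclotomic n iota)
    (B : 'M[rat]_(dim X))
    (B_form : invariant_form phi (weyl_group pairing Phi coroot) B)
    (d : nat) (d_gt0 : (0 < d)%N)
    (zeta : R[i]) (zeta_prim : d.-primitive_root zeta)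
    (Sigma : {fset X}) (Sigma_sub : (Sigma `<=` Phi)%fset) :
  [/\ split_levi iota phi B Phi d (split_closure iota phi Phi zeta Sigma),
      (Sigma `<=` split_closure iota phi Phi zeta Sigma)%fset,
      (forall Psi : {fset X}, split_levi iota phi B Phi d Psi ->
         (Sigma `<=` Psi)%fset ->
         (split_closure iota phi Phi zeta Sigma `<=` Psi)%fset) &
      (split_levi iota phi B Phi d Sigma <->
         Sigma = split_closure iota phi Phi zeta Sigma)].

Proof.
have [n_gt0 phi_n _] := phi_order.
have [w w_prim] := cyclotomic_prim_root n_gt0 K_cyclotomic.
pose A : 'M[rat]_(dim X) := map_mx intr (f2mx phi).
have An : A ^+ n = 1 by rewrite -map_mxX f2mx_exp // map_mx1.
have [_ B_pos B_gen] := B_form.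
have B_inv : A *m B *m A^T = B.
  apply: bilinear_mx_inj => x y.
  have := B_gen phi (generated_gen (or_intror erefl)) x y.
  by rewrite /formQ !base_change_endE trmx_mul !mulmxA.
pose S := [seq base_change rat a | a <- Sigma].
pose C := split_closure iota phi Phi zeta Sigma.
have mem_C a : (a \in C) = (a \in Phi) &&
    (base_change K a \in (eigen_proj iota phi zeta @^-1:
      (eigen_proj iota phi zeta @: spanK K Sigma))%VS) by rewrite !inE.
have sub_C : (Sigma `<=` C)%fset.
  apply/fsubsetP => a Sa; rewrite mem_C (fsubsetP Sigma_sub) //=.
  by rewrite -memv_preim memv_img // memv_span // map_f.
(* The final equivalence is minimality applied to [Sigma] itself. *)
suff [split_C min_C] : split_levi iota phi B Phi d C /\
    forall Psi : {fset X}, split_levi iota phi B Phi d Psi ->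
      (Sigma `<=` Psi)%fset -> (C `<=` Psi)%fset.
  split=> //; split=> [Sigma_split|->//].
  by apply/eqP; rewrite eqEfsubset sub_C min_C.
(* If [zeta] is not in the image of [K], both theta and X_K(phi, d) vanish: the closure is all of
   [Phi], and every admissible [E] is 0 with perpendicular roots [Phi]. *)
have [[z Dz]|zeta_out] := pselect (exists z, iota z = zeta); last first.
  split.
    exists 0%VS; split.
    - by rewrite limg0 subvv.
    - move=> _ [e /= + <-]; rewrite memv0 => /eqP ->; split.
        by rewrite /XQ_to_XK map_mx0 mem0v.
      by move=> g; apply: galois_act_rat.
    - apply/fsetP => a; apply/idP/idP; rewrite mem_C.
        case/andP=> aPhi _; apply/mem_roots_perp; split=> // e.
        by rewrite memv0 => /eqP ->; rewrite trmx0 !mulmx0.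
      case/mem_roots_perp => -> _ /=.
      by rewrite -memv_preim eigen_proj_out // mem0v.
  move=> Psi [E [_ E_sub ->]] _; apply/fsubsetP => a; rewrite mem_C.
  case/andP=> aPhi _; apply/mem_roots_perp; split=> // e Ee.
  have [] := E_sub (XQ_to_XK K e); first by exists e.
  rewrite (eigenspace_ord_out phi zeta_prim zeta_out) memv0 map_mx_eq0 => /eqP -> _.
  by rewrite trmx0 !mulmx0.
have z_prim : d.-primitive_root z by rewrite -(fmorph_primitive_root iota) Dz.
pose p : {poly rat} := map_poly intr 'Phi_d.
have AK_E : map_mx (in_alg K) A = map_mx intr (f2mx phi).
  by apply/matrixP => i j; rewrite !mxE rmorph_int.
have CP a : a \in C <-> a \in Phi /\
    forall c : 'cV[rat]_(dim X), poly_mx A p *m c = 0 ->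
      {in S, forall s i, s *m A ^+ i *m c = 0} -> base_change rat a *m c = 0.
  have spanP (c : 'cV[K]_(dim X)) :
      {in S, forall s, map_mx (in_alg K) s *m c = 0} <->
      (forall s, s \in spanK K Sigma -> s *m c = 0).
    split=> [Sc s|Sc _ /mapP[b Sb ->]]; last first.
      by rewrite -base_change_rat Sc // memv_span // map_f.
    have spc : (spanK K Sigma <= lker (linfun (mulmxr c)))%VS.
      apply/span_subvP => _ /mapP[b Sb ->]; rewrite memv_ker lfunE /=.
      by rewrite base_change_rat Sc // map_f.
    by move/(subvP spc); rewrite memv_ker lfunE /= => /eqP.
  have := eigen_annihilatorP (in_alg K) n_gt0 An z_prim S (base_change rat a).
  rewrite -base_change_rat AK_E => <-.
  rewrite mem_C -Dz; split.
    case/andP=> -> /(mem_eigen_proj_preim iota phi_n w_prim) aC; split=> // c Sc Ac.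
    by apply: aC => //; apply/spanP.
  case=> -> aC; apply/(mem_eigen_proj_preim iota phi_n w_prim) => c Sc Ac.
  by apply: aC => //; apply/spanP.
split.
  have [E EP] := annihilator_vspace B (krylov_rows n A p S).
  have {}EP e : e \in E <-> poly_mx A p *m (B *m e^T) = 0 /\
      {in S, forall s i, s *m A ^+ i *m (B *m e^T) = 0}.
    rewrite EP -(krylov_rowsP _ _ _ n_gt0 An).
    by split=> Ee t Tt; have := Ee t Tt; rewrite mulmxA.
  (* Applying phi to [e] multiplies the column [B e^T] by [A^-1]. As this is a power of [A], the
     conditions defining [E] are preserved, which gives phi-stability. *)
  have adj (e : 'rV_(dim X)) : B *m (e *m A)^T = A ^+ n.-1 *m (B *m e^T).
    rewrite -{2}B_inv !mulmxA mulmxE -exprSr prednK // An mul1r.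
    by rewrite -!mulmxA -trmx_mul.
  exists E; split.
  - apply/subvP => _ /memv_imgP[e /EP[pe Se] ->]; apply/EP.
    rewrite base_change_endE -/A adj; split=> [|s Ss i].
      rewrite (mulmxA _ _ (B *m _)); have -> := @poly_mx_intertwine _ _ A (A ^+ n.-1) A p; last first.
        by rewrite mulmxE -exprS exprSr.
      by rewrite -mulmxA pe mulmx0.
    by rewrite mulmxA -(mulmxA s) mulmxE -exprD Se.
  - move=> _ [e /= /EP[pe _] <-]; split; last by move=> g; apply: galois_act_rat.
    exact: (poly_mx_eigenspace_ord iota phi_n w_prim B_pos B_inv z_prim pe).
  - apply/fsetP => a; apply/idP/idP.
      case/CP => aPhi aC; apply/mem_roots_perp; split=> // e /EP[].
      exact: aC.
    (* Nondegeneracy writes every admissible column as [B e^T], and the conditions on it say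
       precisely that [e] lies in [E]. *)
    case/mem_roots_perp => aPhi aE; apply/CP; split=> // c pc Sc.
    have [e Dc] := form_surj B_pos c.
    by rewrite Dc; apply: aE; apply/EP; rewrite -Dc.
(* For minimality, each [e] in the space [E] defining [Psi] must give an admissible column [B e^T]:
   [p(A)] kills it because [E] lies in X_Q(phi, d). *)
move=> Psi [E [E_stable E_sub ->]] Sigma_E; apply/fsubsetP => a /CP[aPhi aC].
apply/mem_roots_perp; split=> // e Ee; apply: aC.
  apply: (eigenspace_ord_poly_mx (iota := iota) phi_n w_prim B_inv).
  by have [|] := E_sub (XQ_to_XK K e); first by exists e.
(* By adjointness [b A^i B e^T] is the form of [b] with [e A^((n-1) i)]. The latter stays in the
   phi-stable [E], to which [Sigma] is orthogonal. *)
move=> _ /mapP[b Sb ->] i; rewrite -mulmxA (mulmxA _ B).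
rewrite (form_adjoint_exp n_gt0 An B_inv) -mulmxA -trmx_mul -exprM.
have /mem_roots_perp[_] := fsubsetP Sigma_E b Sb; apply.
elim: (_ * i)%N => [|k IHk]; first by rewrite mulmx1.
rewrite exprSr -mulmxE mulmxA; apply: (subvP E_stable); apply/memv_imgP.
by exists (e *m A ^+ k); rewrite // base_change_endE.
Qed.
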